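(* Let $(X,\mu)$ and $(Y,\nu)$ be standard measure spaces and $\kappa\subseteq X\times Y$ be an $\omega$-closed set which possesses an m-resolution $(\kappa_\beta)_{\beta\le\alpha}$ such that $\kappa_\beta\setminus\kappa_{\beta+1}$ is an operator $U$-set for each $\beta<\alpha$, and $\kappa_\alpha$ is an operator $U$-set. Then $\kappa$ is an operator $U$-set.
   Context: Standard measure space: $\mu,\nu$ are ($\sigma$-finite) regular Borel measures with respect to some complete (separable) metrisable topologies. $H_1=L^2(X,\mu)$, $H_2=L^2(Y,\nu)$. A rectangle is $\alpha\times\beta$ with measurable sides. A set is marginally null if contained in $(X_0\times Y)\cup(X\times Y_0)$ with $\mu(X_0)=\nu(Y_0)=0$; sets are marginally equivalent ($\simeq$) if their symmetric difference is marginally null. A set is $\omega$-open if marginally equivalent to a countable union of rectangles; $\omega$-closed means complement $\omega$-open. An $\omega$-closed set $\kappa$ supports $T\in\mathcal B(H_1,H_2)$ if $P(\beta)TP(\alpha)=0$ whenever $(\alpha\times\beta)\cap\kappa\simeq\emptyset$, where $P(\cdot)$ is multiplication by the characteristic function. $\mathfrak M_{\max}(\kappa)$ is the space of all operators supported on $\kappa$ (the largest weak* closed masa-bimodule with support $\kappa$). $\kappa$ is an operator $U$-set if the only compact operator in $\mathfrak M_{\max}(\kappa)$ is $0$. For $k\in L^2(Y\times X)$ let $T_k:H_1\to H_2$, $T_k\xi(y)=\int k(y,x)\xi(x)d\mu(x)$. A measurable function $\varphi$ on $X\times Y$ is a Schur multiplier, $\varphi\in\mathfrak S(X,Y)$,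 if the map $T_k\mapsto T_{\hat\varphi k}$, $\hat\varphi(y,x)=\varphi(x,y)$, on Hilbert–Schmidt operators is bounded in the operator norm. A pair $(\kappa_1,\kappa_2)$ of $\omega$-closed subsets of $X\times Y$ is m-separable if there exist $\varphi\in\mathfrak S(X,Y)$ and $\omega$-open neighbourhoods $E_1,E_2$ of $\kappa_1,\kappa_2$ respectively such that $\varphi|_{E_1}=1$ and $\varphi|_{E_2}=0$. Let $\alpha$ be a countable ordinal. A family $(\kappa_\beta)_{\beta\le\alpha}$ of $\omega$-closed sets (indexed by ordinals $1\le\beta\le\alpha$) is an m-resolution of the $\omega$-closed set $\kappa$ if: $\kappa_1=\kappa$; for every ordinal $\beta<\alpha$, $\kappa_{\beta+1}\subseteq\kappa_\beta$, the set $\kappa_\beta\setminus\kappa_{\beta+1}$ is $\omega$-closed and the pair $(\kappa_{\beta+1},\kappa_\beta\setminus\kappa_{\beta+1})$ is m-separable; and $\kappa_\beta=\bigcap_{\gamma<\beta}\kappa_\gamma$ for every limit ordinal $\beta\le\alpha$. *)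

(* Defs.v *)
From HB Require Import structures.
From mathcomp Require Import all_boot all_order all_algebra.
From mathcomp Require Import generic_quotient ring_quotient complex.
From mathcomp Require Import all_classical all_reals all_analysis.
From mathcomp Require Import measurable_realfun wochoice.

Set Implicit Arguments.
Unset Strict Implicit.
Unset Printing Implicit Defensive.

Import Order.TTheory GRing.Theory Num.Theory.
Import numFieldNormedType.Exports.
Import ComplexField.Normc.

Local Open Scope classical_set_scope.
Local Open Scope ring_scope.
Local Open Scope quotient_scope.
Local Open Scope complex_scope.

(* The L^p spaces of [hoelder] are real; these are the complex L^2 spaces. *)
Section L2_functions.
Context d (T : measurableType d) (R : realType).
Variable mu : {measure set T -> \bar R}.
Implicit Types f g : T -> R[i].

Definition cmeasurable f : Prop :=
  measurable_fun [set: T] (fun x => complex.Re (f x)) /\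
  measurable_fun [set: T] (fun x => complex.Im (f x)).

Definition sq_integrable f : Prop :=
  cmeasurable f /\ finite_norm mu 2%:E (fun x => normc (f x)).

Lemma measurable_normc f : cmeasurable f ->
  measurable_fun [set: T] (fun x => normc (f x)).
Proof.
move=> [mr mi].
have -> : (fun x => normc (f x)) = Num.sqrt \o
    (fun x => complex.Re (f x) ^+ 2 + complex.Im (f x) ^+ 2).
  by apply/funext => x /=; case: (f x).
apply: measurableT_comp; first exact: (continuous_measurable_fun (@sqrt_continuous R)).
by apply: measurable_funD; exact: measurable_funX.
Qed.

Lemma normc_ge0 (z : R[i]) : 0 <= normc z.
Proof. by case: z => a b; exact: sqrtr_ge0. Qed.

Lemma Lnorm_le (p q : T -> R) : measurable_fun [set: T] p ->
  measurable_fun [set: T] q -> (forall x, `|p x| <= `|q x|) ->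
  ('N[mu]_2%:E[EFin \o p] <= 'N[mu]_2%:E[EFin \o q])%E.
Proof.
move=> mp mq pq; rewrite unlock /Lnorm.
have r0 r : (0 <= \int[mu]_x (`|r x : R| `^ 2)%:E)%E.
  by apply: integral_ge0 => x _; rewrite lee_fin powR_ge0.
rewrite gt0_ler_poweR// ?invr_ge0// ?in_itv/= ?leey ?andbT//.
apply: ge0_le_integral => //=.
- apply/measurable_EFinP/(measurableT_comp (measurable_powR _)).
  exact: measurableT_comp.
- apply/measurable_EFinP/(measurableT_comp (measurable_powR _)).
  exact: measurableT_comp.
- by move=> x _; rewrite lee_fin ge0_ler_powR// ?nnegrE.
Qed.

Lemma finite_norm_le (p q : T -> R) : measurable_fun [set: T] p ->
  measurable_fun [set: T] q -> (forall x, `|p x| <= `|q x|) ->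
  finite_norm mu 2%:E q -> finite_norm mu 2%:E p.
Proof. by move=> mp mq pq; apply: le_lt_trans; exact: Lnorm_le. Qed.

Lemma LnormZ2 (q : T -> R) (c : R) : measurable_fun [set: T] q ->
  finite_norm mu 2%:E q ->
  ('N[mu]_2%:E[EFin \o (fun x => c * q x)%R] =
    `|c|%:E * 'N[mu]_2%:E[EFin \o q])%E.
Proof.
move=> mq fq; have qL : q \in Lfun mu 2%:E by rewrite inE; apply/andP; rewrite !inE.
have le12 : (1 <= 2%:E :> \bar R)%E by rewrite lee_fin ler1n.
exact: (LnormZ (Lfun_Sub le12 qL) c).
Qed.

Lemma cmeasurableD f g :
  cmeasurable f -> cmeasurable g -> cmeasurable (fun x => f x + g x).
Proof.
move=> [fr fi] [gr gi]; split.
- rewrite (_ : (fun _ => _) = (fun x => complex.Re (f x)) \+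
    (fun x => complex.Re (g x))); first exact: measurable_funD.
  by apply/funext => x /=; case: (f x) (g x) => ? ? [].
- rewrite (_ : (fun _ => _) = (fun x => complex.Im (f x)) \+
    (fun x => complex.Im (g x))); first exact: measurable_funD.
  by apply/funext => x /=; case: (f x) (g x) => ? ? [].
Qed.

Lemma cmeasurableM f g :
  cmeasurable f -> cmeasurable g -> cmeasurable (fun x => f x * g x).
Proof.
move=> [fr fi] [gr gi]; split.
- rewrite (_ : (fun _ => _) =
    ((fun x => complex.Re (f x)) \* (fun x => complex.Re (g x))) \-
    ((fun x => complex.Im (f x)) \* (fun x => complex.Im (g x)))).
    by apply: measurable_funB; exact: measurable_funM.
  by apply/funext => x /=; case: (f x) (g x) => ? ? [].
- rewrite (_ : (fun _ => _) =
    ((fun x => complex.Re (f x)) \* (fun x => complex.Im (g x))) \+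
    ((fun x => complex.Im (f x)) \* (fun x => complex.Re (g x)))).
    by apply: measurable_funD; exact: measurable_funM.
  by apply/funext => x /=; case: (f x) (g x) => ? ? [].
Qed.

Lemma cmeasurable_cst (c : R[i]) : cmeasurable (fun=> c).
Proof. by split; exact: measurable_cst. Qed.

Lemma normcD (z w : R[i]) : normc (z + w) <= normc z + normc w.
Proof. exact: (@le_normcD R z w). Qed.

Lemma sq_integrableZ (c : R[i]) f :
  sq_integrable f -> sq_integrable (fun x => c * f x).
Proof.
move=> [mf ff]; split; first exact: (cmeasurableM (cmeasurable_cst c)).
rewrite /finite_norm (_ : (fun x => normc _) = (fun x => normc c * normc (f x))).
  rewrite LnormZ2 //; last exact: measurable_normc.
  by rewrite lte_mul_pinfty// lee_fin.
by apply/funext => x; exact: normcM.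
Qed.

Lemma Lnorm_normcD f g : cmeasurable f -> cmeasurable g ->
  ('N[mu]_2%:E[EFin \o (fun x => normc (f x + g x)%R)] <=
   'N[mu]_2%:E[EFin \o (fun x => normc (f x))] +
   'N[mu]_2%:E[EFin \o (fun x => normc (g x))])%E.
Proof.
move=> mf mg; have le12 : (1 <= 2%:E :> \bar R)%E by rewrite lee_fin ler1n.
have [nf ng] := (measurable_normc mf, measurable_normc mg).
apply: le_trans (eminkowski mu nf ng le12); apply: Lnorm_le.
- exact: measurable_normc (cmeasurableD mf mg).
- exact: measurable_funD.
- by move=> x /=; rewrite !ger0_norm ?addr_ge0 ?normc_ge0// normcD.
Qed.

Lemma sq_integrableD f g :
  sq_integrable f -> sq_integrable g -> sq_integrable (fun x => f x + g x).
Proof.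
move=> [mf ff] [mg gf]; split; first exact: cmeasurableD.
apply: (le_lt_trans (Lnorm_normcD mf mg)).
by rewrite lte_add_pinfty.
Qed.

Lemma sq_integrable0 : sq_integrable (fun=> 0).
Proof.
split; first exact: cmeasurable_cst.
rewrite /finite_norm (_ : (fun=> normc _) = cst 0).
  by rewrite Lnorm0 ?ltry// eqe pnatr_eq0.
by apply/funext => x; exact: normc0.
Qed.

Definition L2fun_pred : {pred T -> R[i]} := mem [set f | sq_integrable f].

Lemma L2fun_submod_closed : submod_closed L2fun_pred.
Proof.
split; first by rewrite inE; exact: sq_integrable0.
move=> c f g; rewrite !inE => fL gL.
exact: (sq_integrableD (sq_integrableZ c fL) gL).
Qed.

HB.instance Definition _ := GRing.isSubmodClosed.Build _ _ L2fun_pred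
  L2fun_submod_closed.

Record L2fun := mkL2fun { L2fun_val :> T -> R[i] ; _ : L2fun_val \in L2fun_pred }.
HB.instance Definition _ := [isSub for L2fun_val].
HB.instance Definition _ := [Choice of L2fun by <:].
HB.instance Definition _ := [SubChoice_isSubLmodule of L2fun by <:].

Definition L2null_pred : {pred L2fun} :=
  mem [set f : L2fun | \forall x \ae mu, (f : T -> R[i]) x = 0].

Lemma L2null_submod_closed : submod_closed L2null_pred.
Proof.
split; first by rewrite inE; exact: aeW.
move=> c f g; rewrite !inE => f0 g0.
apply: filterS2 f0 g0 => x fx gx.
by rewrite -[LHS]/(c * f x + g x) fx gx mulr0 addr0.
Qed.

HB.instance Definition _ := GRing.isSubmodClosed.Build _ _ L2null_pred
  L2null_submod_closed.

Definition L2 : Type := Quotient.quot L2null_pred.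
HB.instance Definition _ := GRing.Zmodule.on L2.

Definition L2_repr (u : L2) : T -> R[i] := repr u.
Coercion L2_repr : L2 >-> Funclass.

Lemma L2_repr_sq_integrable (u : L2) : sq_integrable u.
Proof. by have := valP (repr u); rewrite inE. Qed.

Lemma L2_piP (f g : L2fun) :
  (\pi_L2 f = \pi_L2 g) <-> (\forall x \ae mu, f x = g x).
Proof.
have eqE : \pi_L2 f = \pi_L2 g <-> f - g \in L2null_pred.
  by rewrite (Quotient.idealrBE L2null_pred f g); split => /eqP.
rewrite eqE inE /=; split; apply: filterS => x.
  by rewrite -[LHS]/(f x - g x) => /eqP; rewrite subr_eq0 => /eqP.
by move=> fg; rewrite -[LHS]/(f x - g x) fg subrr.
Qed.

Lemma L2_reprK (f : L2fun) : \forall x \ae mu, (\pi_L2 f : L2) x = f x.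
Proof. by apply/L2_piP; rewrite reprK. Qed.

Lemma L2_eqP (u v : L2) : u = v <-> (\forall x \ae mu, u x = v x).
Proof. by rewrite -[in X in X <-> _](reprK u) -[in X in X <-> _](reprK v); exact: L2_piP. Qed.

Definition L2scale (c : R[i]) (u : L2) : L2 := \pi_L2 (c *: repr u).

Lemma L2_pi_eq (f g : L2fun) : (\forall x \ae mu, f x = g x) ->
  \pi_L2 f = \pi_L2 g.
Proof. by move/L2_piP. Qed.

Lemma pi_L2scale (c : R[i]) (f : L2fun) :
  L2scale c (\pi_L2 f) = \pi_L2 (c *: f).
Proof.
apply: L2_pi_eq; have := L2_reprK f; apply: filterS => x fx.
by rewrite -[LHS]/(c * (\pi_L2 f : L2) x) fx.
Qed.

Lemma pi_L2add (f g : L2fun) : \pi_L2 (f + g) = \pi_L2 f + \pi_L2 g.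
Proof. by rewrite (Quotient.pi_add L2null_pred). Qed.

Lemma L2_ind (P : L2 -> Prop) : (forall f : L2fun, P (\pi_L2 f)) -> forall u, P u.
Proof. by move=> Ppi u; rewrite -[u]reprK; exact: Ppi. Qed.

Lemma L2scaleA a b (u : L2) : L2scale a (L2scale b u) = L2scale (a * b) u.
Proof. by elim/L2_ind: u => f; rewrite !pi_L2scale scalerA. Qed.

Lemma L2scale1 : left_id 1 L2scale.
Proof. by elim/L2_ind => f; rewrite pi_L2scale scale1r. Qed.

Lemma L2scaleDr : right_distributive L2scale +%R.
Proof.
move=> a; elim/L2_ind => f; elim/L2_ind => g.
by rewrite -pi_L2add !pi_L2scale -pi_L2add scalerDr.
Qed.

Lemma L2scaleDl u : {morph L2scale^~ u : a b / a + b}.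
Proof.
by move=> a b; elim/L2_ind: u => f; rewrite !pi_L2scale -pi_L2add scalerDl.
Qed.

HB.instance Definition _ := GRing.Zmodule_isLmodule.Build R[i] L2
  L2scaleA L2scale1 L2scaleDr L2scaleDl.

Definition L2norm (u : L2) : R :=
  fine ('N[mu]_2%:E[EFin \o (fun x => normc (u x))]).

Lemma EFin_L2norm (u : L2) :
  (L2norm u)%:E = ('N[mu]_2%:E[EFin \o (fun x => normc (u x))])%E.
Proof.
have [_ fu] := L2_repr_sq_integrable u.
by rewrite fineK// fin_numElt (lt_le_trans ltNy0) ?Lnorm_ge0.
Qed.

Lemma Lnorm_ae_eq (p q : T -> R) : measurable_fun [set: T] p ->
  measurable_fun [set: T] q -> (\forall x \ae mu, p x = q x) ->
  ('N[mu]_2%:E[EFin \o p] = 'N[mu]_2%:E[EFin \o q])%E.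
Proof.
move=> mp mq pq; rewrite unlock /Lnorm; congr poweR.
apply: ge0_ae_eq_integral => //=.
- apply/measurable_EFinP/(measurableT_comp (measurable_powR _)).
  exact: measurableT_comp.
- apply/measurable_EFinP/(measurableT_comp (measurable_powR _)).
  exact: measurableT_comp.
- by move: pq; apply: filterS => x /= -> _.
Qed.

Lemma L2norm_ae (u : L2) f : cmeasurable f -> (\forall x \ae mu, u x = f x) ->
  (L2norm u)%:E = ('N[mu]_2%:E[EFin \o (fun x => normc (f x))])%E.
Proof.
move=> mf uf; rewrite EFin_L2norm; apply: Lnorm_ae_eq.
- by apply: measurable_normc; have [] := L2_repr_sq_integrable u.
- exact: measurable_normc.
- by move: uf; apply: filterS => x ->.
Qed.

Lemma L2_addE (u v : L2) : \forall x \ae mu, (u + v : L2) x = u x + v x.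
Proof.
have := L2_reprK (repr u + repr v).
by rewrite pi_L2add !reprK; apply: filterS => x ->.
Qed.

Lemma L2_scaleE (c : R[i]) (u : L2) : \forall x \ae mu, (c *: u : L2) x = c * u x.
Proof. by have := L2_reprK (c *: repr u); apply: filterS => x ->. Qed.

Lemma L2normD (u v : L2) : (L2norm (u + v))%:C <= (L2norm u)%:C + (L2norm v)%:C.
Proof.
have [[mu_ _] [mv _]] := (L2_repr_sq_integrable u, L2_repr_sq_integrable v).
rewrite -rmorphD lecR -lee_fin EFinD (L2norm_ae _ (L2_addE u v)).
  by rewrite !EFin_L2norm Lnorm_normcD.
exact: cmeasurableD.
Qed.

Lemma L2normZ (c : R[i]) (u : L2) : (L2norm (c *: u))%:C = `|c| * (L2norm u)%:C.
Proof.
have [mu_ fu] := L2_repr_sq_integrable u.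
have -> : `|c| = (normc c)%:C by case: c.
rewrite -rmorphM; congr (_ %:C); apply/EFin_inj.
rewrite (L2norm_ae _ (L2_scaleE c u)).
  rewrite (_ : (fun x => normc _) = (fun x => normc c * normc (u x))).
    rewrite LnormZ2//; last exact: measurable_normc.
    by rewrite -EFin_L2norm ger0_norm ?normc_ge0.
  by apply/funext => x; exact: normcM.
exact: cmeasurableM (cmeasurable_cst c) mu_.
Qed.

Lemma L2norm_eq0 (u : L2) : (L2norm u)%:C = 0 -> u = 0.
Proof.
case=> u0; have [mu_ _] := L2_repr_sq_integrable u.
have mn : measurable_fun [set: T] (EFin \o (fun x => normc (u x))).
  exact/measurable_EFinP/measurable_normc.
have : ('N[mu]_2%:E[EFin \o (fun x => normc (u x))] = 0)%E by rewrite -EFin_L2norm u0.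
move/(Lnorm_eq0_eq0 mn); rewrite lte_fin ltr0n => /(_ isT) ae0.
apply/L2_eqP; have := L2_reprK (0 : L2fun).
rewrite (_ : \pi_L2 0 = 0); last first.
  by apply: (@addrI _ (\pi_L2 0)); rewrite -pi_L2add !addr0.
by apply: filterS2 ae0 => x /(_ I) [/eq0_normc ->] ->.
Qed.

HB.instance Definition _ := Lmodule_isNormed.Build R[i] L2
  L2normD L2normZ L2norm_eq0.

End L2_functions.

Section L2_constructions.
Context d (T : measurableType d) (R : realType).
Variable mu : {measure set T -> \bar R}.

(* The class of [f], or 0 if [f] is not square-integrable; below it is only
   used on square-integrable functions. *)
Definition to_L2 (f : T -> R[i]) : L2 mu :=
  \pi_(L2 mu) (insubd (0 : L2fun mu) f).

Lemma to_L2E f : sq_integrable mu f -> \forall x \ae mu, to_L2 f x = f x.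
Proof.
move=> fL; have := L2_reprK (insubd (0 : L2fun mu) f).
by apply: filterS => x ->; rewrite insubdK ?inE.
Qed.

Definition indic_proj (A : set T) (u : L2 mu) : L2 mu :=
  to_L2 (fun x => \1_A x * u x).

Lemma indic_proj_sq_integrable (A : set T) (u : L2 mu) : measurable A ->
  sq_integrable mu (fun x => \1_A x * u x).
Proof.
move=> mA; have [mu_ fu] := L2_repr_sq_integrable u.
have mA1 : cmeasurable (fun x => \1_A x : R[i]).
  split; last first.
    rewrite (_ : (fun x => _) = cst 0); first exact: measurable_cst.
    by apply/funext => x; rewrite /indic; case: (x \in A).
  rewrite (_ : (fun x => _) = \1_A); first exact: measurable_indic.
  by apply/funext => x; rewrite /indic; case: (x \in A).
split; first exact: cmeasurableM.
apply: finite_norm_le fu; first exact: measurable_normc (cmeasurableM mA1 mu_).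
  exact: measurable_normc.
move=> x; rewrite normcM !ger0_norm ?mulr_ge0 ?normc_ge0//.
rewrite ler_piMl ?normc_ge0// /indic; case: (x \in A).
  by rewrite (@normc1 R).
by rewrite (@normc0 R).
Qed.

(* Lebesgue integral of a complex function, by real and imaginary parts. *)
Definition cintegral (f : T -> R[i]) : R[i] :=
  (\int[mu]_x complex.Re (f x))%R +i* (\int[mu]_x complex.Im (f x))%R.

End L2_constructions.

Section kernel_op_well_defined.
Context d1 d2 (X : measurableType d1) (Y : measurableType d2) (R : realType).
Variables (mu : {sigma_finite_measure set X -> \bar R}).
Variables (nu : {sigma_finite_measure set Y -> \bar R}).
Variables (k : L2 (nu \x mu)%E) (u : L2 mu).

Let a (p : Y * X) : R := normc (k p).
Let b (x : X) : R := normc (u x).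

Let ma : measurable_fun [set: Y * X] a.
Proof. by apply: measurable_normc; case: (L2_repr_sq_integrable k). Qed.

Let mb : measurable_fun [set: X] b.
Proof. by apply: measurable_normc; case: (L2_repr_sq_integrable u). Qed.

Let Rint_sq_integrable (g : Y * X -> R) : measurable_fun [set: Y * X] g ->
  (forall p, `|g p| <= a p * b p.2) ->
  measurable_fun [set: Y] (fun y => \int[mu]_x g (y, x))%R /\
  finite_norm nu 2%:E (fun y => \int[mu]_x g (y, x))%R.
Proof.
move=> mg gab.
have mG : measurable_fun [set: Y] (fun y => \int[mu]_x (g (y, x))%:E)%E.
  rewrite (_ : (fun y => _) = fun y =>
      fubini_F mu (EFin \o g)^\+%E y - fubini_F mu (EFin \o g)^\-%E y)%E; last first.
    apply/funext => y; rewrite [LHS]integralE /fubini_F.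
    by congr (_ - _)%E; apply: eq_integral => x _; rewrite ?funeposE ?funenegE.
  have mEg : measurable_fun [set: Y * X] (EFin \o g).
    exact/measurable_EFinP.
  apply: emeasurable_funB; apply: measurable_fun_fubini_tonelli_F => //.
  - exact: measurable_funepos.
  - exact: measurable_funeneg.
have mG' : measurable_fun [set: Y] (fun y => \int[mu]_x g (y, x))%R.
  exact: measurableT_comp mG.
split=> //; rewrite /finite_norm unlock /Lnorm poweR_lty//.
pose c := L2norm u ^+ 2.
have le1 y : ((`|\int[mu]_x g (y, x)| `^ 2)%R%:E <=
    c%:E * fubini_F mu (fun p => (a p `^ 2)%:E) y)%E.
  have msec : measurable_fun [set: X] (fun x => g (y, x)).
    exact: measurableT_comp mg (measurable_pair1 y).
  have masec : measurable_fun [set: X] (fun x => a (y, x)).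
    exact: measurableT_comp ma (measurable_pair1 y).
  have h1 : (`|\int[mu]_x g (y, x)|%R%:E <=
      'N[mu]_2%:E[EFin \o (fun x => a (y, x))] *
      'N[mu]_2%:E[EFin \o b])%E.
    apply: (@le_trans _ _ `|\int[mu]_x (g (y, x))%:E|%E).
      by rewrite /Rintegral; case: (\int[mu]_x _)%E => [r| |]; rewrite ?lexx ?leey.
    apply: le_trans (le_abse_integral _ _ _) _ => //; first exact/measurable_EFinP.
    have := @hoelder _ _ _ mu (fun x => a (y, x)) b 2 2 masec mb.
    have h2 : (2^-1 + 2^-1 = 1 :> R)%R by rewrite [RHS](splitr 1) !mul1r.
    move=> /(_ (ltr0n _ 2) (ltr0n _ 2) h2); apply: le_trans.
    rewrite Lnorm1; apply: ge0_le_integral => //=.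
    - exact/measurable_EFinP/measurableT_comp.
    - by apply/measurable_EFinP/measurableT_comp => //; exact: measurable_funM.
    - by move=> x _; rewrite lee_fin (le_trans (gab (y, x)))// ler_norm.
  have nb : ('N[mu]_2%:E[EFin \o b] `^ 2 = c%:E)%E.
    rewrite -[X in (X `^ _)%E](EFin_L2norm u) poweR_EFin powR_mulrn//.
    by rewrite -lee_fin EFin_L2norm Lnorm_ge0.
  rewrite -nb (_ : fubini_F _ _ _ =
      'N[mu]_2%:E[EFin \o (fun x => a (y, x))] `^ 2)%E; last first.
    rewrite powR_Lnorm// /fubini_F; apply: eq_integral => x _.
    by rewrite /= ger0_norm// normc_ge0.
  rewrite muleC -poweRM ?Lnorm_ge0// -poweR_EFin.
  by rewrite gt0_ler_poweR// in_itv/= leey andbT ?lee_fin// mule_ge0 ?Lnorm_ge0.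
have ma2 : measurable_fun [set: Y * X] (fun p => (a p `^ 2)%:E).
  by apply/measurable_EFinP; apply: (measurableT_comp (measurable_powR _)).
have a20 p : (0 <= (a p `^ 2)%:E)%E by rewrite lee_fin powR_ge0.
apply: (@le_lt_trans _ _
    (\int[nu]_y (c%:E * fubini_F mu (fun p => (a p `^ 2)%:E) y))%E).
  apply: ge0_le_integral => //=.
  - by apply/measurable_EFinP; apply: (measurableT_comp (measurable_powR _)); exact: measurableT_comp.
  - by apply: emeasurable_funM => //; exact: measurable_fun_fubini_tonelli_F.
rewrite ge0_integralZl//; last 3 first.
- exact: measurable_fun_fubini_tonelli_F.
- by move=> y _; apply: integral_ge0 => x _.
- by rewrite lee_fin sqr_ge0.
rewrite -fubini_tonelli1// lte_mul_pinfty ?lee_fin ?sqr_ge0//.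
have [_ fk] := L2_repr_sq_integrable k.
have := poweR_lty 2 fk; rewrite powR_Lnorm//.
by under eq_integral => p _ do rewrite /= ger0_norm ?normc_ge0//.
Qed.

Lemma kernel_op_sq_integrable :
  sq_integrable nu (fun y => cintegral mu (fun x => k (y, x) * u x)).
Proof.
have [[mk _] [mu_ _]] := (L2_repr_sq_integrable k, L2_repr_sq_integrable u).
have mu2_ : cmeasurable (fun p : Y * X => u p.2).
  by case: mu_ => ur ui; split;
    [exact: measurableT_comp ur measurable_snd|exact: measurableT_comp ui measurable_snd].
have [mr mi] := cmeasurableM mk mu2_.
have absRe (z : R[i]) : `|complex.Re z| <= normc z.
  by case: z => r s /=; rewrite -sqrtr_sqr ler_wsqrtr// lerDl sqr_ge0.
have absIm (z : R[i]) : `|complex.Im z| <= normc z.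
  by case: z => r s /=; rewrite -sqrtr_sqr ler_wsqrtr// lerDr sqr_ge0.
have [] := @Rint_sq_integrable _ mr.
  by move=> p; rewrite /a /b -normcM absRe.
have [] := @Rint_sq_integrable _ mi.
  by move=> p; rewrite /a /b -normcM absIm.
set gi := (fun y => _); set gr := (fun y => _) => mgi fgi mgr fgr.
have real_sq (h : Y -> R) : measurable_fun [set: Y] h -> finite_norm nu 2%:E h ->
    sq_integrable nu (fun y => (h y)%:C).
  move=> mh fh; split; first by split => //; exact: measurable_cst.
  apply: finite_norm_le fh => //; first by apply: measurable_normc; split.
  by move=> y /=; rewrite expr0n addr0 sqrtr_sqr normr_id.
have := sq_integrableD (real_sq gr mgr fgr) (sq_integrableZ 'i (real_sq gi mgi fgi)).
congr sq_integrable; apply/funext => y.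
by rewrite /cintegral -/(gr y) -/(gi y) [RHS]complexE mulrC.
Qed.

End kernel_op_well_defined.

Section operators.
Context d1 d2 (X : measurableType d1) (Y : measurableType d2) (R : realType).
Variables (mu : {sigma_finite_measure set X -> \bar R}).
Variables (nu : {sigma_finite_measure set Y -> \bar R}).

(* The norm is taken in [\bar R]: it is finite exactly for bounded operators. *)
Definition opnorm (T : L2 mu -> L2 nu) : \bar R :=
  ereal_sup [set (L2norm (T u))%:E | u in [set u | L2norm u <= 1]].

Definition compact_operator (T : L2 mu -> L2 nu) : Prop :=
  precompact (T @` [set u | `|u| <= 1]).

Definition marginally_null (E : set (X * Y)) : Prop :=
  exists (X0 : set X) (Y0 : set Y),
    [/\ measurable X0, mu X0 = 0%E, measurable Y0, nu Y0 = 0%E &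
        E `<=` (X0 `*` [set: Y]) `|` ([set: X] `*` Y0)].

Definition marginally_equiv (E F : set (X * Y)) : Prop :=
  marginally_null (E `+` F).

Definition omega_open (E : set (X * Y)) : Prop :=
  exists (A : nat -> set X) (B : nat -> set Y),
    [/\ forall n, measurable (A n), forall n, measurable (B n) &
        marginally_equiv E (\bigcup_n (A n `*` B n))].

Definition omega_closed (E : set (X * Y)) : Prop := omega_open (~` E).

Definition supports (kappa : set (X * Y)) (T : L2 mu -> L2 nu) : Prop :=
  forall (A : set X) (B : set Y), measurable A -> measurable B ->
    marginally_equiv ((A `*` B) `&` kappa) set0 ->
    forall u, indic_proj B (T (indic_proj A u)) = 0.

Definition Mmax (kappa : set (X * Y)) : set {linear L2 mu -> L2 nu} :=
  [set T | (opnorm T < +oo)%E /\ supports kappa T].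

Definition operator_U_set (kappa : set (X * Y)) : Prop :=
  forall T : {linear L2 mu -> L2 nu},
    Mmax kappa T -> compact_operator T -> forall u, T u = 0.

Definition kernel_op (k : L2 (nu \x mu)%E) (u : L2 mu) : L2 nu :=
  to_L2 nu (fun y => cintegral mu (fun x => k (y, x) * u x)).

Definition schur_mul (phi : X * Y -> R[i]) (k : L2 (nu \x mu)%E) :
    Y * X -> R[i] :=
  fun p => phi (p.2, p.1) * k p.

(* The second clause says that [T_k |-> T_{phi k}] is defined on all
   Hilbert-Schmidt operators. *)
Definition schur_multiplier (phi : X * Y -> R[i]) : Prop :=
  [/\ cmeasurable phi,
      forall k : L2 (nu \x mu)%E, sq_integrable (nu \x mu)%E (schur_mul phi k) &
      exists C : R, forall k : L2 (nu \x mu)%E,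
        (opnorm (kernel_op (to_L2 (nu \x mu)%E (schur_mul phi k)))
           <= C%:E * opnorm (kernel_op k))%E].

Definition m_separable (kappa1 kappa2 : set (X * Y)) : Prop :=
  exists (phi : X * Y -> R[i]) (E1 E2 : set (X * Y)),
    [/\ schur_multiplier phi,
        omega_open E1 /\ kappa1 `<=` E1,
        omega_open E2 /\ kappa2 `<=` E2,
        forall p, E1 p -> phi p = 1 &
        forall p, E2 p -> phi p = 0].

End operators.

#[short(type="completeMetricType")]
HB.structure Definition CompleteMetric (R : numFieldType) :=
  {T of Metric R T & Complete T}.

(* [X] carries the complete metrisable topology, and its Borel sigma-algebra. *)
Notation borel X := (g_sigma_algebraType (@open X)).

Section standard_measure.
Context (R : realType) (X : completeMetricType R).

Definition regular_measure (mu : set (borel X) -> \bar R) : Prop :=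
  forall A : set (borel X), measurable A ->
    mu A = ereal_inf [set mu U | U in [set U : set X | open U /\ A `<=` U]] /\
    mu A = ereal_sup [set mu K | K in [set K : set X | compact K /\ K `<=` A]].

Definition standard_measure (mu : {sigma_finite_measure set (borel X) -> \bar R})
    : Prop :=
  (exists2 D : set X, countable D & dense D) /\ regular_measure mu.

End standard_measure.

Section well_orders.
Context (disp : Order.disp_t) (W : tbOrderType disp).

Definition is_succ (b c : W) : Prop :=
  (b < c)%O /\ forall x : W, (b < x)%O -> (c <= x)%O.

Definition is_limit (b : W) : Prop := b != \bot%O /\ ~ exists a, is_succ a b.

End well_orders.

(* The ordinals [1 <= b <= alpha] are the elements of a well-order with a least
   element [\bot], playing 1, and a greatest element [\top], playing [alpha];
   every nonempty well-order with a maximum is of this form for a unique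
   [alpha]. *)
Definition m_resolution d1 d2 (X : measurableType d1) (Y : measurableType d2)
    (R : realType) (mu : {sigma_finite_measure set X -> \bar R})
    (nu : {sigma_finite_measure set Y -> \bar R})
    (disp : Order.disp_t) (W : tbOrderType disp)
    (kappa : set (X * Y)) (kap : W -> set (X * Y)) : Prop :=
  [/\ well_order (<=%O : rel W) /\ countable [set: W],
      forall b, omega_closed mu nu (kap b),
      kap \bot%O = kappa,
      forall b c, is_succ b c ->
        [/\ kap c `<=` kap b,
            omega_closed mu nu (kap b `\` kap c) &
            m_separable mu nu (kap c) (kap b `\` kap c)] &
      forall b, is_limit b ->
        kap b = \bigcap_(c in [set c : W | (c < b)%O]) kap c].

(* Main.v *)
Require Import Defs.
From HB Require Import structures.
From mathcomp Require Import all_boot all_order all_algebra complex.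
From mathcomp Require Import all_classical all_reals all_analysis.
From mathcomp Require Import measurable_realfun.

(* Uniqueness passes through the resolution by well-founded induction: a compact
   operator T supported on kappa is shown to be supported on every kap b, hence
   on the last one, so that T = 0.  At a successor, if A x B misses kap (b+1)
   marginally, then P(B) T P(A) is compact and supported on kap b \ kap (b+1),
   hence zero.  At a limit, a rectangle missing the intersection is marginally
   covered by countably many rectangles F_i x G_i with P(G_i) T P(F_i) = 0; by
   regularity its sides are, up to null sets, countable unions of compact sets
   on which all the F_i (resp. G_i) are relatively open, so that finitely many
   F_i x G_i cover each product of these compact sets. *)

Set Implicit Arguments.
Unset Strict Implicit.
Unset Printing Implicit Defensive.

Import Order.TTheory GRing.Theory Num.Theory.
Import numFieldNormedType.Exports.
Import ComplexField.Normc.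

Local Open Scope classical_set_scope.
Local Open Scope ring_scope.
Local Open Scope complex_scope.

(** * Multiplication by characteristic functions on L^2 *)

Section indic_proj_theory.
Context d (T : measurableType d) (R : realType) (mu : {measure set T -> \bar R}).
Implicit Types (A B : set T) (u v : L2 mu).

Lemma indic_projE A u : measurable A ->
  \forall x \ae mu, indic_proj A u x = \1_A x * u x.
Proof. by move=> mA; exact/to_L2E/indic_proj_sq_integrable. Qed.

Lemma indic_proj_eqP A u v : measurable A ->
  (indic_proj A u = v) <-> (\forall x \ae mu, \1_A x * u x = v x).
Proof.
move=> mA; have h := indic_projE u mA; split=> [<-|uv].
  by apply: filterS h => x ->.
by apply/L2_eqP; apply: filterS2 h uv => x ->.
Qed.

Lemma L2_linE (c : R[i]) u v :
  \forall x \ae mu, (c *: u + v : L2 mu) x = c * u x + v x.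
Proof.
apply: filterS2 (L2_addE (c *: u) v) (L2_scaleE c u) => x e1 e2.
exact: etrans e1 (congr1 (+%R^~ (v x)) e2).
Qed.

Lemma indic_proj_linear A : measurable A -> linear (@indic_proj _ _ _ mu A).
Proof.
move=> mA c u v; apply/indic_proj_eqP => //.
have hu := indic_projE u mA; have hv := indic_projE v mA.
have h1 := L2_linE c u v; have h2 := L2_linE c (indic_proj A u) (indic_proj A v).
near=> x; apply: etrans (congr1 (GRing.mul _) (near h1 x _)) _ => //.
apply: etrans _ (esym (near h2 x _)) => //.
have -> // := near hu x; have -> // := near hv x.
by rewrite mulrDr mulrCA.
Unshelve. all: by end_near. Qed.

Lemma indic_projD A u v : measurable A ->
  indic_proj A (u + v) = indic_proj A u + indic_proj A v.
Proof. by move=> mA; have := indic_proj_linear mA 1 u v; rewrite !scale1r. Qed.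

Lemma indic_projN A u : measurable A -> indic_proj A (- u) = - indic_proj A u.
Proof.
move=> mA; apply/eqP; rewrite -addr_eq0 -indic_projD// addNr.
have := indic_projD 0 0 mA; rewrite addr0 => /eqP.
by rewrite -subr_eq subrr eq_sym.
Qed.

Lemma indic_projB A u v : measurable A ->
  indic_proj A (u - v) = indic_proj A u - indic_proj A v.
Proof. by move=> mA; rewrite indic_projD// indic_projN. Qed.

Lemma indic_proj0 A : measurable A -> indic_proj A (0 : L2 mu) = 0.
Proof. by move=> mA; rewrite -[X in indic_proj _ X](subrr 0) indic_projB ?subrr. Qed.

(** The representative chosen for the class 0 need not be the zero function; comparing
    representatives in 0 + 0 = 0 shows that it vanishes almost everywhere. *)
Lemma L2_zeroE : \forall x \ae mu, (0 : L2 mu) x = 0.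
Proof.
have := L2_addE (0 : L2 mu) 0; rewrite addr0; apply: filterS => x /eqP.
by rewrite -subr_eq subrr eq_sym => /eqP.
Qed.

Lemma indic_proj_eq0P A u : measurable A ->
  (indic_proj A u = 0) <-> (\forall x \ae mu, A x -> u x = 0).
Proof.
move=> mA; split => [/indic_proj_eqP-/(_ mA) h|h].
  apply: filterS2 h L2_zeroE => x e0 z0 Ax.
  by have := etrans e0 z0; rewrite indicE mem_set// mul1r.
apply/indic_proj_eqP => //; apply: filterS2 h L2_zeroE => x h z0.
apply: etrans _ (esym z0); rewrite indicE; case: (boolP (x \in A)) => [|_]; last by rewrite mul0r.
by rewrite inE => /h ->; rewrite mulr0.
Qed.

Lemma indic_projI A B u : measurable A -> measurable B ->
  indic_proj A (indic_proj B u) = indic_proj (A `&` B) u.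
Proof.
move=> mA mB; apply/indic_proj_eqP => //.
apply: filterS2 (indic_projE u mB) (indic_projE u (measurableI _ _ mA mB)).
by move=> x -> ->; rewrite indicI mulrA.
Qed.

Lemma indic_projU A B u : measurable A -> measurable B -> A `&` B = set0 ->
  indic_proj (A `|` B) u = indic_proj A u + indic_proj B u.
Proof.
move=> mA mB AB; apply/indic_proj_eqP; first exact: measurableU.
have h := L2_addE (indic_proj A u) (indic_proj B u).
apply: filterS3 (indic_projE u mA) (indic_projE u mB) h => x hA hB ->.
rewrite hA hB -mulrDl !indicE in_setU; congr (_ * _).
case: (boolP (x \in A)); case: (boolP (x \in B)) => /=; rewrite ?addr0 ?add0r//.
rewrite !inE => Bx Ax.
by have : (A `&` B) x by []; rewrite AB.
Qed.

Lemma L2norm_ge0 u : 0 <= L2norm u.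
Proof. by rewrite -lee_fin EFin_L2norm Lnorm_ge0. Qed.

Lemma L2norm_indic_proj_le A u : measurable A ->
  L2norm (indic_proj A u) <= L2norm u.
Proof.
move=> mA; rewrite -lee_fin.
have [mAu _] := indic_proj_sq_integrable u mA.
have [mu_ _] := L2_repr_sq_integrable u.
rewrite (L2norm_ae mAu (indic_projE u mA)) EFin_L2norm.
apply: Lnorm_le; [exact: measurable_normc..|move=> x].
rewrite !ger0_norm ?normc_ge0// normcM ler_piMl ?normc_ge0// indicE.
by case: (x \in A); rewrite ?normc1 ?normc0.
Qed.

Lemma L2norm_eq0E u : L2norm u = 0 -> u = 0.
Proof. by move=> u0; apply: L2norm_eq0; rewrite u0. Qed.

Lemma L2norm0 : L2norm (0 : L2 mu) = 0.
Proof. by have /(congr1 (@complex.Re R)) := @normr0 _ (L2 mu). Qed.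

Lemma L2norm_scale (c : R) u : 0 <= c -> L2norm (c%:C *: u) = c * L2norm u.
Proof.
by move=> c0; have := L2normZ c%:C u; rewrite ger0_norm ?lecR// -rmorphM => -[].
Qed.

Lemma L2norm_sqr u :
  ((L2norm u ^+ 2)%:E = \int[mu]_x (normc (u x) ^+ 2)%:E)%E.
Proof.
rewrite -powR_mulrn ?L2norm_ge0// -poweR_EFin EFin_L2norm powR_Lnorm//.
by apply: eq_integral => x _ /=; rewrite ger0_norm ?normc_ge0// powR_mulrn ?normc_ge0.
Qed.

(** Dominated convergence with dominating function |u|^2, since the tails of the union shrink to the
    empty set. With boundedness of an operator this handles countable unions on the domain side. *)
Lemma indic_proj_bigcup_cvg (F : (set T)^nat) u : (forall n, measurable (F n)) ->
  (L2norm (indic_proj (\bigcup_n F n `\` \big[setU/set0]_(i < n) F i) u) ^+ 2)%:E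
    @[n --> \oo] --> 0%E.
Proof.
move=> mF; set D := fun n => _.
pose G n := \bigcup_n F n `\` \big[setU/set0]_(i < n) F i.
have mG n : measurable (G n).
  by apply: measurableD; [exact: bigcup_measurable|exact: bigsetU_measurable].
have [mu_ _] := L2_repr_sq_integrable u.
have mu2 : measurable_fun setT (fun x => (normc (u x) ^+ 2)%:E).
  by apply/measurable_EFinP/measurable_funX/measurable_normc.
have Dn n : D n = (\int[mu]_x (\1_(G n) x * (normc (u x) ^+ 2))%:E)%E.
  rewrite /D L2norm_sqr; apply: ae_eq_integral => //.
  - apply/measurable_EFinP/measurable_funX/measurable_normc.
    by have [] := L2_repr_sq_integrable (indic_proj (G n) u).
  - apply/measurable_EFinP/measurable_funM; first exact: measurable_indic.
    exact/measurable_EFinP.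
  - apply: filterS (indic_projE u (mG n)) => x -> _.
    rewrite normcM exprMn !indicE.
    by case: (_ \in _); rewrite ?normc1 ?normc0 ?expr1n ?expr0n.
rewrite (_ : D = fun n => \int[mu]_x (\1_(G n) x * (normc (u x) ^+ 2))%:E)%E; last exact/funext.
have := @dominated_convergence _ _ _ mu setT measurableT
  (fun n x => (\1_(G n) x * (normc (u x) ^+ 2))%:E) (cst 0%E)
  (fun x => (normc (u x) ^+ 2)%:E).
case=> //.
- move=> n; apply/measurable_EFinP/measurable_funM; first exact: measurable_indic.
  exact/measurable_EFinP.
(* A point of [F k] has left the n-th tail once n > k, so the integrands are eventually 0 at every
   point. *)
- apply: aeW => x _; apply: cvg_near_cst.
  have [[k _ Fk]|nF] := pselect ((\bigcup_n F n) x).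
    exists k.+1 => // n /= kn; rewrite indicE memNset ?mul0r// => -[_].
    by apply; rewrite -bigcup_mkord; exists k.
  by apply: nearW => n; rewrite indicE memNset ?mul0r// => -[].
- apply/integrableP; split => //.
  under eq_integral => x _ do rewrite gee0_abs ?lee_fin ?sqr_ge0//.
  by rewrite -L2norm_sqr ltry.
- apply: aeW => x n _; rewrite gee0_abs ?lee_fin; last first.
    by rewrite mulr_ge0 ?sqr_ge0// indicE.
  by rewrite ler_piMl ?sqr_ge0// indicE; case: (_ \in _).
by move=> _ _; rewrite integral0.
Qed.

End indic_proj_theory.

(** * Rectangles on which an operator vanishes, and compressions to rectangles *)

Section annihilation.
Context d1 d2 (X : measurableType d1) (Y : measurableType d2) (R : realType).
Variables (mu : {sigma_finite_measure set X -> \bar R}).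
Variables (nu : {sigma_finite_measure set Y -> \bar R}).
Implicit Types (T : {linear L2 mu -> L2 nu}) (A : set X) (B : set Y).

(** This isolates the condition in [supports] for a single rectangle, so that it can be propagated
    through unions of rectangles apart from any [kappa]. *)
Definition annihilates (T : L2 mu -> L2 nu) A B :=
  forall u, indic_proj B (T (indic_proj A u)) = 0.

(** By homogeneity, after rescaling [u] into the unit ball; vectors of norm 0 are treated first
    because the rescaling divides by the norm. *)
Lemma opnorm_bounded T : (opnorm T < +oo)%E ->
  exists2 M : R, 0 <= M & forall u, L2norm (T u) <= M * L2norm u.
Proof.
move=> Too.
have in_ball u : L2norm u <= 1 -> ((L2norm (T u))%:E <= opnorm T)%E.
  by move=> u1; apply: ereal_sup_ubound; exists u.
have T0 : (0 <= opnorm T)%E.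
  apply: le_trans (in_ball 0 _); first by rewrite lee_fin L2norm_ge0.
  by rewrite L2norm0.
have fT : opnorm T \is a fin_num by rewrite ge0_fin_numE.
exists (fine (opnorm T)); first exact: fine_ge0.
move=> u; have := L2norm_ge0 u; rewrite le_eqVlt => /predU1P[/esym u0|u0].
  by rewrite u0 mulr0 (L2norm_eq0E u0) linear0 L2norm0.
have /in_ball : L2norm ((L2norm u)^-1%:C *: u) <= 1.
  by rewrite L2norm_scale ?invr_ge0 ?(ltW u0)// mulVf ?lexx// gt_eqF.
rewrite linearZ/= L2norm_scale ?invr_ge0 ?(ltW u0)// -[X in (_ <= X)%E]fineK// lee_fin.
by rewrite ler_pdivrMl// mulrC.
Qed.

Lemma annihilatesS T A A' B B' : measurable A -> measurable A' ->
  measurable B -> measurable B' -> A' `<=` A -> B' `<=` B ->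
  annihilates T A B -> annihilates T A' B'.
Proof.
move=> mA mA' mB mB' AA' BB' TAB u.
rewrite -(setIidr AA') -(setIidl BB') -!indic_projI//.
by rewrite TAB indic_proj0.
Qed.

Lemma annihilatesUl T A1 A2 B : measurable A1 -> measurable A2 ->
  measurable B -> annihilates T A1 B -> annihilates T A2 B ->
  annihilates T (A1 `|` A2) B.
Proof.
move=> mA1 mA2 mB T1 T2 u.
(* Projections add up only over disjoint sets, so the union is split into [A1] and the rest of
   [A2]. *)
have mD : measurable (A2 `\` A1) by exact: measurableD.
have T2' := annihilatesS mA2 mD mB mB (@subDsetl _ _ _) (@subset_refl _ _) T2.
rewrite -(setDUK (@subsetUl _ A1 A2)) setDUl setDv set0U indic_projU//;
  last by rewrite setDE setICA setICr setI0.
by rewrite linearD indic_projD// T1 T2' addr0.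
Qed.

(** On the range side the condition is vanishing almost everywhere on each [F n], and countably many
    null sets have a null union. *)
Lemma annihilates_bigcupr T A (F : (set Y)^nat) : (forall n, measurable (F n)) ->
  (forall n, annihilates T A (F n)) -> annihilates T A (\bigcup_n F n).
Proof.
move=> mF TF u; apply/indic_proj_eq0P; first exact: bigcup_measurable.
have : \forall x \ae nu, forall n, F n x -> (T (indic_proj A u) : L2 nu) x = 0.
  by apply/ae_foralln => n; apply/indic_proj_eq0P => //; exact: TF.
by apply: filterS => x h [n _]; exact: h.
Qed.

Lemma annihilatesUr T A B1 B2 : measurable B1 -> measurable B2 ->
  annihilates T A B1 -> annihilates T A B2 -> annihilates T A (B1 `|` B2).
Proof.
move=> mB1 mB2 T1 T2 u.
move: (T1 u) (T2 u) => /indic_proj_eq0P-/(_ mB1) h1 /indic_proj_eq0P-/(_ mB2) h2.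
apply/indic_proj_eq0P; first exact: measurableU.
by apply: filterS2 h1 h2 => x h1 h2 [].
Qed.

Lemma annihilates_set0l T B : measurable B -> annihilates T set0 B.
Proof.
move=> mB u; have -> : indic_proj set0 u = 0.
  by apply/indic_proj_eq0P => //; exact: aeW.
by rewrite linear0 indic_proj0.
Qed.

(** On the domain side the condition is not pointwise: finite unions are handled by additivity, and
    the remaining tail contributes little because T is bounded. *)
Lemma annihilates_bigcupl T (F : (set X)^nat) B : (opnorm T < +oo)%E ->
  (forall n, measurable (F n)) -> measurable B ->
  (forall n, annihilates T (F n) B) -> annihilates T (\bigcup_n F n) B.
Proof.
move=> /opnorm_bounded[M M0 TM] mF mB TF u.
have mU n : measurable (\big[setU/set0]_(i < n) F i) by exact: bigsetU_measurable.
have TU n : annihilates T (\big[setU/set0]_(i < n) F i) B.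
  elim: n => [|n IH]; first by rewrite big_ord0; exact: annihilates_set0l.
  by rewrite big_ord_recr /=; apply: annihilatesUl => //; exact: mU.
have mD n : measurable (\bigcup_n F n `\` \big[setU/set0]_(i < n) F i).
  by apply: measurableD => //; exact: bigcup_measurable.
apply: L2norm_eq0E; apply/eqP; rewrite -sqrf_eq0 eq_le sqr_ge0 andbT -lee_fin.
(* For every n the squared norm to be shown zero is at most M^2 times that of the n-th tail of [u],
   since T annihilates the first n sets; this bound tends to 0. *)
have cv := @cvgeZl _ _ _ _ _ (M ^+ 2)%:E isT (indic_proj_bigcup_cvg u mF).
rewrite mule0 in cv; apply: cvge_ge cv; apply: nearW => n.
rewrite -EFinM lee_fin -exprMn ler_sqr ?nnegrE ?mulr_ge0 ?L2norm_ge0//.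
have -> : indic_proj (\bigcup_n F n) u =
    indic_proj (\big[setU/set0]_(i < n) F i) u +
    indic_proj (\bigcup_n F n `\` \big[setU/set0]_(i < n) F i) u.
  rewrite -indic_projU//; last by rewrite setDE setICA setICr setI0.
  by rewrite setDUK// -bigcup_mkord => x [k _ Fk]; exists k.
by rewrite linearD indic_projD// TU add0r (le_trans (L2norm_indic_proj_le _ mB)).
Qed.

(** Induction on the list: cutting away one rectangle leaves two rectangles disjoint from it, which
    the remaining ones must cover. *)
Lemma annihilates_finite_cover T (I : eqType) (s : seq I) (F : I -> set X)
    (G : I -> set Y) A B :
  (forall i, measurable (F i)) -> (forall i, measurable (G i)) ->
  measurable A -> measurable B ->
  (forall i, annihilates T (F i) (G i)) ->
  A `*` B `<=` \bigcup_(i in [set` s]) (F i `*` G i) ->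
  annihilates T A B.
Proof.
move=> mF mG + + TFG; elim: s A B => [|i s IH] A B mA mB AB.
  (* An empty cover forces one of the two sides to be empty. *)
  have [->|/set0P[x Ax]] := eqVneq A set0; first exact: annihilates_set0l.
  have -> : B = set0; last by move=> u; apply/indic_proj_eq0P => //; exact: aeW.
  by rewrite -subset0 => y By; have [] := AB (x, y) (conj Ax By).
have cover A' B' : A' `<=` A -> B' `<=` B ->
    (forall p, (A' `*` B') p -> ~ (F i `*` G i) p) ->
    A' `*` B' `<=` \bigcup_(j in [set` s]) (F j `*` G j).
  move=> AA BB nFG p p'; have [j /= + FGj] := AB p (conj (AA _ p'.1) (BB _ p'.2)).
  rewrite in_cons => /predU1P[ji|js]; last by exists j.
  by case: (nFG p p'); rewrite -ji.
have [mAF mBG] := (measurableI _ _ mA (mF i), measurableI _ _ mB (mG i)).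
have [mAD mBD] := (measurableD mA (mF i), measurableD mB (mG i)).
have TD A' B' : measurable A' -> measurable B' -> A' `<=` A -> B' `<=` B ->
    (forall p, (A' `*` B') p -> ~ (F i `*` G i) p) -> annihilates T A' B'.
  by move=> mA' mB' AA BB nFG; apply: IH => //; exact: cover.
(* The product splits into (A ∩ F i) × (B ∩ G i), inside the removed rectangle, and (A ∩ F i) × (B \
   G i) and (A \ F i) × B, both disjoint from it. *)
rewrite -(setUIDK A (F i)); apply: annihilatesUl => //.
- rewrite -(setUIDK B (G i)); apply: annihilatesUr => //.
    apply: annihilatesS (TFG i) => //; exact: subIsetr.
  apply: TD => //.
  by move=> p [_ [_ nG]] [_ /nG].
- by apply: TD => //; move=> p [[_ nF] _] [/nF].
Qed.

(** Changing a set by a null set does not change its projection on L^2, so only the common parts of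
    [A], [A'] and of [B], [B'] count. *)
Lemma annihilates_mod_null T A A' B B' : measurable A -> measurable A' ->
  measurable B -> measurable B' -> mu (A `\` A') = 0%E -> nu (B `\` B') = 0%E ->
  annihilates T A' B' -> annihilates T A B.
Proof.
move=> mA mA' mB mB' muA nuB TAB u.
have mAA' := measurableI _ _ mA mA'; have mBB' := measurableI _ _ mB mB'.
have -> : indic_proj A u = indic_proj (A `&` A') u.
  rewrite -[in LHS](setUIDK A A') indic_projU//; last first.
  - by rewrite setDE setIACA setICr setI0.
  - exact: measurableD.
  rewrite [X in _ + X](_ : _ = 0) ?addr0//.
  apply/indic_proj_eq0P; first exact: measurableD.
  exists (A `\` A'); split => //; first exact: measurableD.
  by move=> x /= /not_implyP[].
have /indic_proj_eq0P-/(_ mBB') : indic_proj (B `&` B') (T (indic_proj (A `&` A') u)) = 0.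
  exact: annihilatesS TAB u.
move=> h; apply/indic_proj_eq0P => //.
have h' : \forall y \ae nu, ~ (B `\` B') y.
  exists (B `\` B'); split => //; first exact: measurableD.
  by move=> y /= /contrapT.
apply: filterS2 h h' => y h nBB By; apply: h; split => //.
by apply: contrapT => nB'; exact: nBB.
Qed.

Definition compress (T : L2 mu -> L2 nu) A B (u : L2 mu) : L2 nu :=
  indic_proj B (T (indic_proj A u)).

Lemma compress_linear T A B : measurable A -> measurable B ->
  linear (compress T A B).
Proof.
move=> mA mB c u v; rewrite /compress.
by rewrite indic_proj_linear// linearP indic_proj_linear.
Qed.

Lemma opnorm_compress T A B : measurable A -> measurable B ->
  (opnorm (compress T A B) <= opnorm T)%E.
Proof.
move=> mA mB; apply: ge_ereal_sup => _ [u u1 <-].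
apply: (@le_trans _ _ (L2norm (T (indic_proj A u)))%:E).
  by rewrite lee_fin L2norm_indic_proj_le.
apply: ereal_sup_ubound; exists (indic_proj A u) => //=.
exact: le_trans (L2norm_indic_proj_le _ mA) u1.
Qed.

Lemma indic_proj_continuous B : measurable B ->
  continuous (@indic_proj _ _ _ nu B).
Proof.
move=> mB u; have FF := @nbhs_filter (L2 nu) u.
apply/(@cvgrPdist_le _ (L2 nu)) => e e0.
have := @cvgr_dist_le _ (L2 nu) _ _ FF id u (@cvg_id _ _) e e0.
apply: filterS => v; apply: le_trans.
have -> : indic_proj B u - indic_proj B v = indic_proj B (u - v) by rewrite indic_projB.
by rewrite lecR L2norm_indic_proj_le.
Qed.

(** P(A) maps the unit ball into itself, so the image of the ball lies in the continuous image under
    P(B) of the compact closure of T(ball). *)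
Lemma compact_operator_compress T A B : measurable A -> measurable B ->
  compact_operator T -> compact_operator (compress T A B).
Proof.
move=> mA mB; rewrite /compact_operator precompactE => cT.
have cBT : compact (indic_proj B @` closure (T @` [set u : L2 mu | `|u| <= 1])).
  apply: continuous_compact cT; apply: continuous_subspaceT.
  exact: indic_proj_continuous.
apply: precompact_subset (compact_precompact (@norm_hausdorff _ _) cBT).
move=> _ [u /= u1 <-]; exists (T (indic_proj A u)) => //.
apply: subset_closure; exists (indic_proj A u) => //=.
by apply: le_trans u1; rewrite lecR L2norm_indic_proj_le.
Qed.

Lemma marginally_equiv0 (E : set (X * Y)) :
  marginally_equiv mu nu E set0 <-> marginally_null mu nu E.
Proof. by rewrite /marginally_equiv setY0. Qed.

Lemma marginally_nullU (E F : set (X * Y)) : marginally_null mu nu E ->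
  marginally_null mu nu F -> marginally_null mu nu (E `|` F).
Proof.
move=> [X1 [Y1 [mX1 X10 mY1 Y10 EXY]]] [X2 [Y2 [mX2 X20 mY2 Y20 FXY]]].
exists (X1 `|` X2), (Y1 `|` Y2); split.
- exact: measurableU.
- by rewrite measureU0.
- exact: measurableU.
- by rewrite measureU0.
- move=> p [/EXY|/FXY] [[px _]|[_ py]].
  + by left; split=> //; left.
  + by right; split=> //; left.
  + by left; split=> //; right.
  + by right; split=> //; right.
Qed.

Lemma marginally_nullS (E F : set (X * Y)) : E `<=` F ->
  marginally_null mu nu F -> marginally_null mu nu E.
Proof.
move=> EF [X0 [Y0 [mX0 X00 mY0 Y00 FXY]]]; exists X0, Y0; split=> //.
exact: subset_trans FXY.
Qed.

(* Compressing to a rectangle that misses [kappa'] moves the support into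
   [kappa `\` kappa']; this makes the uniqueness of the difference applicable
   without any Schur multiplier. *)
Lemma supports_of_operator_U_set T (kappa kappa' : set (X * Y)) :
  operator_U_set mu nu (kappa `\` kappa') -> Mmax kappa T ->
  compact_operator T -> supports kappa' T.
Proof.
move=> U [Too Tkappa] cT A B mA mB ABk'.
have mAB := compress_linear T mA mB.
pose lS := GRing.isLinear.Build _ _ _ _ (compress T A B) mAB.
pose S : {linear L2 mu -> L2 nu} := HB.pack (compress T A B) lS.
apply: (U S); last exact: compact_operator_compress.
split; first exact: le_lt_trans (opnorm_compress T mA mB) Too.
move=> A' B' mA' mB' AB'k u /=; rewrite /compress !indic_projI//.
apply: Tkappa; [exact: measurableI..|].
apply/marginally_equiv0.
move/marginally_equiv0: ABk' => /marginally_nullU-/(_ _ (iffLR (marginally_equiv0 _) AB'k)).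
apply: marginally_nullS => p [[[Ap1 A'p1] [B'p2 Bp2]] kp].
(* Points of [kappa'] fall into the null set given by [ABk'], the others into the one given by
   [AB'k]. *)
have [k'p|nk'p] := pselect (kappa' p); first by left.
by right.
Qed.

End annihilation.

(** * Inner approximation by compact sets, and finite subcovers *)

Section borel_exhaustion.
Context (R : realType) (X : completeMetricType R).
Implicit Types (F : (set (borel X))^nat) (A K : set (borel X)).

Lemma compact_measurable_borel (K : set X) : compact K ->
  measurable (K : set (borel X)).
Proof.
move=> /(compact_closed (@metric_hausdorff R X)) cK.
rewrite -[K]setCK; apply: measurableC.
by apply: sub_sigma_algebra; exact: closed_openC.
Qed.

(** All the [F i] are relatively open in the compact [K]; this is what makes covers by Borel
    rectangles accessible to compactness. *)
Definition adapted F (K : set X) :=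
  compact K /\ forall i, exists2 U : set X, open U & K `&` U = K `&` F i.

Variable mu : {sigma_finite_measure set (borel X) -> \bar R}.
Hypothesis regular_mu : regular_measure mu.

(** Finiteness of [mu A] turns approximation of the supremum into smallness of the measure of the
    difference. *)
Lemma inner_regular A (e : R) : measurable A -> (mu A < +oo)%E -> 0 < e ->
  exists K : set X, [/\ compact K, K `<=` A & (mu (A `\` K) <= e%:E)%E].
Proof.
move=> mA Aoo e0; set S := [set mu K | K in [set K : set X | compact K /\ K `<=` A]].
have muA : mu A = ereal_sup S by have [] := regular_mu mA.
have fA : mu A \is a fin_num by rewrite ge0_fin_numE.
have [|_ [K [cK KA] <-] AK] := @ub_ereal_sup_adherent _ S _ e0.
  by rewrite -muA.
exists K; split=> //; have mK := compact_measurable_borel cK.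
rewrite measureD// setIidr//.
have fK : mu K \is a fin_num.
  by rewrite ge0_fin_numE// (le_lt_trans _ Aoo)// le_measure ?inE.
by rewrite leeBlDr// addeC -leeBlDr//; move: (ltW AK); rewrite -muA.
Qed.

(** A Lusin-type argument: each A \ F i is replaced by a compact [C i] up to a small set [N i]. Off
    all the [N i], membership in [F i] is the open condition of avoiding [C i], so any compact [K]
    chosen there is adapted. *)
Lemma adapted_approx F A (e : R) : (forall i, measurable (F i)) ->
  measurable A -> (mu A < +oo)%E -> 0 < e ->
  exists K : set X, [/\ adapted F K, K `<=` A & (mu (A `\` K) <= e%:E)%E].
Proof.
move=> mF mA Aoo e0.
have e20 : 0 < e / 2 by rewrite divr_gt0.
have mAF i : measurable (A `\` F i) by exact: measurableD.
have /choice[C HC] i : exists C : set X, [/\ compact C, C `<=` A `\` F i &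
    (mu ((A `\` F i) `\` C) <= (e / 2 / (2 ^ i.+1)%:R)%:E)%E].
  apply: inner_regular => //.
    by rewrite (le_lt_trans _ Aoo)// le_measure ?inE//; exact: subDsetl.
  by rewrite divr_gt0// ltr0n expn_gt0.
pose N i : set (borel X) := (A `\` F i) `\` C i.
have mN i : measurable (N i).
  by apply: measurableD => //; have [/compact_measurable_borel] := HC i.
have mUN : measurable (\bigcup_i N i) by exact: bigcup_measurable.
have mA' : measurable (A `\` \bigcup_i N i) by exact: measurableD.
have [|K [cK KA muK]] := inner_regular mA' _ e20.
  by rewrite (le_lt_trans _ Aoo)// le_measure ?inE//; exact: subDsetl.
have mK := compact_measurable_borel cK.
exists K; split.
- split=> // i; exists (~` C i).
    have [cC _ _] := HC i.
    exact/closed_openC/(compact_closed (@metric_hausdorff R X)).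
  have [_ CF _] := HC i; apply/seteqP; split=> x [Kx Cx]; split => //.
    apply: contrapT => nFx; have [Ax] := KA _ Kx; apply; exists i => //.
  by move=> /CF[].
- by move=> x /KA[].
- have mAK : measurable (A `\` K) by exact: measurableD.
  have AK : A `\` K `<=` (\bigcup_i N i) `|` ((A `\` \bigcup_i N i) `\` K).
    move=> x [Ax nKx]; have [Nx|nNx] := pselect ((\bigcup_i N i) x); first by left.
    by right.
  have mAK' : measurable ((A `\` \bigcup_i N i) `\` K) by exact: measurableD.
  (* Half of [e] pays for the union of the [N i], through the geometric weights, and the other half
     for the choice of [K]. *)
  apply: (le_trans (le_measure mu _ _ AK)); rewrite ?inE//; first exact: measurableU.
  apply: (le_trans (measureU2 _ _ _)) => //.
  rewrite [e]splitr EFinD leeD//.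
  apply: (le_trans (measure_sigma_subadditive mu mN mUN (@subset_refl _ _))).
  apply: le_trans (epsilon_trick0 xpredT (ltW e20)).
  by apply: lee_nneseries => // i _; have [_ _] := HC i.
Qed.

(** The first index runs over pieces [S m] of finite measure, the second over the precisions 1/(n+1)
    on each piece. *)
Lemma adapted_exhaustion F A : (forall i, measurable (F i)) -> measurable A ->
  exists K : nat -> nat -> set X,
    [/\ forall m n, adapted F (K m n), forall m n, K m n `<=` A &
        mu (A `\` \bigcup_m \bigcup_n K m n) = 0%E].
Proof.
move=> mF mA; have [S ST mS] := sigma_finiteT mu.
have mAS m : measurable (A `&` S m) by apply: measurableI => //; have [] := mS m.
have /choice[K HK] (p : nat * nat) : exists K : set X, [/\ adapted F K, K `<=` A `&` S p.1 &
    (mu ((A `&` S p.1) `\` K) <= (p.2.+1%:R^-1)%:E)%E].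
  apply: adapted_approx => //.
  have [mSp Soo] := mS p.1.
  by rewrite (le_lt_trans _ Soo)// le_measure ?inE//; exact: subIsetr.
have mK p : measurable (K p : set (borel X)).
  by apply: compact_measurable_borel; have [[]] := HK p.
exists (fun m n => K (m, n)); split.
- by move=> m n; have [] := HK (m, n).
- by move=> m n x Kx; have [_ /(_ _ Kx)[]] := HK (m, n).
have mKm m : measurable (\bigcup_n K (m, n) : set (borel X)).
  by apply: bigcup_measurable.
pose N m : set (borel X) := (A `&` S m) `\` \bigcup_n K (m, n).
have mN m : measurable (N m) by exact: measurableD.
(* For every n, [N m] lies in the part of A ∩ S m missed by [K (m, n)], so its measure is at most
   1/(n+1). *)
have N0 m : mu (N m) = 0%E.
  apply/eqP; rewrite eq_le measure_ge0 andbT; apply/lee_addgt0Pr => e e0.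
  rewrite add0e; have [n ne] := ltr_add_invr e0.
  have [_ _ h] := HK (m, n); apply: (@le_trans _ _ (n.+1%:R^-1)%:E); last first.
    by rewrite lee_fin ltW// -[n.+1%:R^-1]add0r.
  apply: le_trans h; rewrite le_measure ?inE//; first exact: measurableD.
  by apply: setDS => x Kx; exists n.
have mUK : measurable (\bigcup_m \bigcup_n K (m, n) : set (borel X)).
  exact: bigcup_measurable.
have mAU := measurableD mA mUK.
apply/eqP; rewrite eq_le measure_ge0 andbT.
apply: (le_trans (measure_sigma_subadditive mu mN mAU _)).
  move=> x [Ax nK]; have : setT x by []; rewrite ST => -[m _ Sx].
  by exists m => //; split=> // Kx; apply: nK; exists m.
by rewrite eseries0// => m _ _; exact: N0.
Qed.

End borel_exhaustion.

(** On the compact product [K] × [L] the rectangles have the same traces as the open rectangles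
    [U i] × [V i], so finitely many suffice. *)
Lemma adapted_finite_cover (R : realType) (X Y : completeMetricType R)
    (F : (set (borel X))^nat) (G : (set (borel Y))^nat) (K : set X) (L : set Y) :
  adapted F K -> adapted G L -> K `*` L `<=` \bigcup_i (F i `*` G i) ->
  exists s : seq nat, K `*` L `<=` \bigcup_(i in [set` s]) (F i `*` G i).
Proof.
move=> [cK KF] [cL LG] KL.
have /choice[U HU] i : exists U, open U /\ K `&` U = K `&` F i.
  by have [U ? ?] := KF i; exists U.
have /choice[V HV] i : exists V, open V /\ L `&` V = L `&` G i.
  by have [V ? ?] := LG i; exists V.
have := compact_setX cK cL; rewrite compact_near_coveringP.
(* Compactness is used in its near-covering form along [\oo]: each point has a neighbourhood inside
   one [U i] × [V i], where [P n] holds for all n > i, and so one n serves the whole product. *)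
pose P n (p : X * Y) := exists2 i, (i < n)%N & (U i `*` V i) p.
move=> /(_ nat \oo P _)[[x y] [/= Kx Ly]|n _ KLP].
  have [i _ [/= Fx Gy]] := KL (x, y) (conj Kx Ly).
  have [[oU KU] [oV LV]] := (HU i, HV i).
  have [_ Ux] : (K `&` U i) x by rewrite KU.
  have [_ Vy] : (L `&` V i) y by rewrite LV.
  exists (U i `*` V i, [set n | (i < n)%N]) => /=.
    split; last by exists i.+1.
    by exists (U i, V i) => //=; split; exact: open_nbhs_nbhs.
  by move=> [p n] /= [UVp ip]; exists i.
exists (iota 0 n) => -[x y] [/= Kx Ly].
have [i ltin [/= Ux Vy]] := KLP n (leqnn n) (x, y) (conj Kx Ly).
exists i; first by rewrite /= mem_iota.
have [[_ KU] [_ LV]] := (HU i, HV i); split => /=.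
  by have [] : (K `&` F i) x by rewrite -KU.
by have [] : (L `&` G i) y by rewrite -LV.
Qed.

(** * Countable covers by rectangles and countable intersections of supports *)

Section omega_compactness.
Context (R : realType) (X Y : completeMetricType R).
Variables (mu : {sigma_finite_measure set (borel X) -> \bar R}).
Variables (nu : {sigma_finite_measure set (borel Y) -> \bar R}).
Hypotheses (regular_mu : regular_measure mu) (regular_nu : regular_measure nu).
Implicit Type T : {linear L2 mu -> L2 nu}.

(** Cutting along infinitely many rectangles never ends, so the cover is first made finite on each
    product of adapted compact sets; these products are then reassembled by countable unions on both
    sides, up to null sets. *)
Lemma annihilates_countable_cover T (F : (set (borel X))^nat)
    (G : (set (borel Y))^nat) (A : set (borel X)) (B : set (borel Y)) :
  (opnorm T < +oo)%E ->
  (forall i, measurable (F i)) -> (forall i, measurable (G i)) ->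
  measurable A -> measurable B ->
  (forall i, annihilates T (F i) (G i)) ->
  A `*` B `<=` \bigcup_i (F i `*` G i) -> annihilates T A B.
Proof.
move=> Too mF mG mA mB TFG AB.
have [K [KF KA muK]] := adapted_exhaustion regular_mu mF mA.
have [L [LG LB nuL]] := adapted_exhaustion regular_nu mG mB.
have mK m n : measurable (K m n : set (borel X)).
  by apply: compact_measurable_borel; have [] := KF m n.
have mL m n : measurable (L m n : set (borel Y)).
  by apply: compact_measurable_borel; have [] := LG m n.
have mKm m : measurable (\bigcup_n K m n : set (borel X)).
  exact: bigcup_measurable.
have mLm m : measurable (\bigcup_n L m n : set (borel Y)).
  exact: bigcup_measurable.
have mUL : measurable (\bigcup_m \bigcup_n L m n : set (borel Y)).
  exact: bigcup_measurable.
apply: (annihilates_mod_null _ _ _ _ muK nuL) => //; first exact: bigcup_measurable.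
apply: annihilates_bigcupl => // m; apply: annihilates_bigcupl => // n.
apply: annihilates_bigcupr => // m'; apply: annihilates_bigcupr => // n'.
have [|s Ks] := adapted_finite_cover (KF m n) (LG m' n').
  by apply: subset_trans AB => p [/KA Ap /LB Bp].
exact: (annihilates_finite_cover mF mG _ _ TFG Ks).
Qed.

(** Take the rectangles that witness [omega_closed], with [E] the symmetric difference. Each of them
    meets [kappa] only inside [E], so the support condition applies to it. *)
Lemma supports_rectangles T (kappa : set (borel X * borel Y)) :
  omega_closed mu nu kappa -> supports kappa T ->
  exists (F : (set (borel X))^nat) (G : (set (borel Y))^nat)
    (E : set (borel X * borel Y)),
    [/\ forall n, measurable (F n), forall n, measurable (G n),
        forall n, annihilates T (F n) (G n), marginally_null mu nu E &
        ~` kappa `<=` \bigcup_n (F n `*` G n) `|` E].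
Proof.
move=> [F [G [mF mG kFG]]] Tk; exists F, G, (~` kappa `+` \bigcup_n (F n `*` G n)).
split=> //.
- move=> n; apply: Tk => //; apply/marginally_equiv0.
  apply: marginally_nullS kFG => p [FGp kp]; right; split; last by apply.
  by exists n.
- move=> p kp; have [FGp|nFGp] := pselect ((\bigcup_n (F n `*` G n)) p).
    by left.
  by right; left.
Qed.

Lemma marginally_null_bigcup (E : nat -> set (borel X * borel Y)) :
  (forall n, marginally_null mu nu (E n)) ->
  marginally_null mu nu (\bigcup_n E n).
Proof.
move=> /choice[X0 /choice[Y0 E0]]; exists (\bigcup_n X0 n), (\bigcup_n Y0 n); split.
- by apply: bigcup_measurable => n _; have [] := E0 n.
- apply/eqP; rewrite eq_le measure_ge0 andbT.
  apply: (le_trans (measure_sigma_subadditive mu _ _ (@subset_refl _ _))).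
  + by move=> n; have [] := E0 n.
  + by apply: bigcup_measurable => n _; have [] := E0 n.
  + by rewrite eseries0// => n _ _; have [] := E0 n.
- by apply: bigcup_measurable => n _; have [] := E0 n.
- apply/eqP; rewrite eq_le measure_ge0 andbT.
  apply: (le_trans (measure_sigma_subadditive nu _ _ (@subset_refl _ _))).
  + by move=> n; have [] := E0 n.
  + by apply: bigcup_measurable => n _; have [] := E0 n.
  + by rewrite eseries0// => n _ _; have [] := E0 n.
- move=> p [n _]; have [_ _ _ _ h] := E0 n; move=> /h[[px _]|[_ py]].
    by left; split => //; exists n.
  by right; split => //; exists n.
Qed.

(** Off a marginally null set, a point of the rectangle misses some [kap i] and hence lies in one of
    countably many annihilated rectangles covering the complement of [kap i]. *)
Lemma supports_bigcap T (I : Type) (P : set I)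
    (kap : I -> set (borel X * borel Y)) : (opnorm T < +oo)%E -> countable P ->
  (forall i, P i -> omega_closed mu nu (kap i)) ->
  (forall i, P i -> supports (kap i) T) ->
  supports (\bigcap_(i in P) kap i) T.
Proof.
move=> Too /countable_injP[f finj] ckap Tkap A B mA mB /marginally_equiv0 AB0.
have /choice[F /choice[G /choice[E FGE]]] (j : nat) :
    exists (F : (set (borel X))^nat) (G : (set (borel Y))^nat)
    (E : set (borel X * borel Y)),
    [/\ forall n, measurable (F n), forall n, measurable (G n),
        forall n, annihilates T (F n) (G n), marginally_null mu nu E &
        forall i, P i -> f i = j -> ~` kap i `<=` \bigcup_n (F n `*` G n) `|` E].
  (* Indices are replaced by their codes under the injection [f]; a number that codes no index gets
     empty rectangles. *)
  have [[i [Pi fi]]|nP] := pselect (exists i, P i /\ f i = j); last first.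
    exists (fun=> set0), (fun=> set0), set0; split=> //.
    - by move=> _; exact: annihilates_set0l.
    - by exists set0, set0; split.
    - by move=> i Pi fi; case: nP; exists i.
  have [F [G [E [mF mG TFG E0 kFG]]]] := supports_rectangles (ckap _ Pi) (Tkap _ Pi).
  exists F, G, E; split=> // i' Pi' fi'.
  by rewrite (finj i' i) ?inE// fi' fi.
have E0 j : marginally_null mu nu (E j) by have [] := FGE j.
(* All exceptional sets are collected in one pair of null sets, which is then removed from the
   sides, so that the cover becomes exact. *)
have [X0 [Y0 [mX0 X00 mY0 Y00 EXY]]] :=
  marginally_nullU AB0 (marginally_null_bigcup E0).
have mA' := measurableD mA mX0; have mB' := measurableD mB mY0.
have AX : mu (A `\` (A `\` X0)) = 0%E.
  apply: subset_measure0 X00 => //; first exact: measurableD.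
  by rewrite setDD; exact: subIsetr.
have BY : nu (B `\` (B `\` Y0)) = 0%E.
  apply: subset_measure0 Y00 => //; first exact: measurableD.
  by rewrite setDD; exact: subIsetr.
apply: (annihilates_mod_null mA mA' mB mB' AX BY).
(* The code of the index and the number of the rectangle are merged into one sequence by [pickle],
   with the empty set as default. *)
pose F' k := if unpickle k is Some p then F p.1 p.2 else set0 : set (borel X).
pose G' k := if unpickle k is Some p then G p.1 p.2 else set0 : set (borel Y).
apply: (@annihilates_countable_cover T F' G') => //.
- by move=> k; rewrite /F'; case: unpickle => // p; have [] := FGE p.1.
- by move=> k; rewrite /G'; case: unpickle => // p; have [] := FGE p.1.
- move=> k; rewrite /F' /G'; case: unpickle => [p|]; first by have [] := FGE p.1.
  exact: annihilates_set0l.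
move=> p [[Ap nXp] [Bp nYp]].
have nE : ~ (((A `*` B) `&` \bigcap_(i in P) kap i) `|` \bigcup_n E n) p.
  by move=> /EXY[[]|[]].
have [i [Pi nki]] : exists i, P i /\ ~ kap i p.
  apply: contrapT => h; apply: nE; left; split => // i Pi.
  by apply: contrapT => nki; apply: h; exists i.
have [_ _ _ _ /(_ i Pi erefl p nki)] := FGE (f i).
move=> [[n _ FGp]|Ep]; last by case: nE; right; exists (f i).
by exists (pickle (f i, n)) => //; rewrite /F' /G' pickleK.
Qed.

End omega_compactness.

(** * Well-founded induction along the resolution *)

Theorem theorem4p2 (R : realType) (X Y : completeMetricType R)
  (mu : {sigma_finite_measure set (borel X) -> \bar R})
  (nu : {sigma_finite_measure set (borel Y) -> \bar R})
  (hmu : standard_measure mu) (hnu : standard_measure nu)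
  (kappa : set (borel X * borel Y)) (hkappa : omega_closed mu nu kappa)
  (disp : Order.disp_t) (W : tbOrderType disp)
  (kap : W -> set (borel X * borel Y))
  (hres : m_resolution mu nu kappa kap)
  (hdiff : forall b c : W, is_succ b c ->
     operator_U_set mu nu (kap b `\` kap c)%classic)
  (htop : operator_U_set mu nu (kap \top%O)) :
  operator_U_set mu nu kappa.
Proof.
move=> T [Too Tkappa] cT; apply: htop => //; split=> //.
have [[wo cW] ckap kapbot _ kaplim] := hres.
suff Tkap b : supports (kap b) T by exact: Tkap.
apply: contrapT => nTb.
(* The well-order yields a least [c] at which the support condition fails; it is the minimum, a
   successor or a limit, and each case is refuted. *)
have [|c [[nTc Tlt] _]] := wo [pred b | `[< ~ supports (kap b) T >]].
  by exists b; exact/asboolP.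
have {}nTc : ~ supports (kap c) T by apply/asboolP.
have {}Tlt a : (a < c)%O -> supports (kap a) T.
  move=> ac; apply: contrapT => nTa; have /Tlt : a \in [pred b | `[< ~ supports (kap b) T >]].
    exact/asboolP.
  by rewrite leNgt ac.
apply: nTc; have [->|c0] := eqVneq c \bot%O; first by rewrite kapbot.
have [[a ac]|nsucc] := pselect (exists a, is_succ a c).
  apply: (supports_of_operator_U_set (hdiff _ _ ac)) => //.
  by split=> //; apply: Tlt; exact: ac.1.
(* A non-minimal element that is no successor is a limit, and the elements below it form a countable
   index set because [W] is countable. *)
rewrite kaplim//; apply: supports_bigcap => //.
- exact: hmu.2.
- exact: hnu.2.
- exact: sub_countable (subset_card_le (@subsetT _ _)) cW.
Qed.
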